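(* Let $0\le k\le n$ be integers with $n\ge 1$, and let $\Delta\subset\Delta_{n,k}$ be a matroid polytope, i.e. $\Delta=\Delta_{\mathcal{M}}$ for a matroid $\mathcal{M}$ of rank $k$ on $[n]=\{1,\dots,n\}$. If $\Delta$ is a simple polytope, then there exist a partition $(J_1,\dots,J_r)$ of the set $[n]$ and non-negative integers $k_1,\dots,k_r$ with $k_1+\dots+k_r=k$ and $k_i\in\{0,1,|J_i|-1,|J_i|\}$ for each $i$, such that $$\Delta=\Delta_{J_1,k_1}\times\Delta_{J_2,k_2}\times\cdots\times\Delta_{J_r,k_r}\subset\mathbb{R}^{J_1}\times\cdots\times\mathbb{R}^{J_r}=\mathbb{R}^n.$$ In particular, $\Delta$ is a product of simplices (where a point is regarded as a $0$-dimensional simplex).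
   Context: For a finite set $S$, $\mathbb{R}^S$ is the space of real-valued functions on $S$ (so $\mathbb{R}^{[n]}=\mathbb{R}^n$), and for $B\subset S$, $\delta_B\in\mathbb{R}^S$ is the indicator function of $B$. For $0\le k\le|S|$, $\Delta_{S,k}$ is the convex hull of $\{\delta_B\mid B\subset S,\ |B|=k\}$ in $\mathbb{R}^S$; $\Delta_{n,k}=\Delta_{[n],k}$ is called a hypersimplex. A matroid of rank $k$ on $S$ is a nonempty collection $\mathcal{M}$ of $k$-element subsets of $S$ such that if $I,J\in\mathcal{M}$ are distinct and $i\in I\setminus J$, then there is $j\in J\setminus I$ with $(I\setminus\{i\})\cup\{j\}\in\mathcal{M}$. Its matroid polytope $\Delta_{\mathcal{M}}$ is the convex hull of $\{\delta_I\mid I\in\mathcal{M}\}$ in $\mathbb{R}^S$. A polytope of dimension $d$ is simple if each of its vertices lies on exactly $d$ edges. A partition of a set is a decomposition into pairwise disjoint nonempty subsets whose union is the set; for a partition $(J_1,\dots,J_r)$ of $[n]$, $\mathbb{R}^n$ is identified with $\mathbb{R}^{J_1}\times\cdots\times\mathbb{R}^{J_r}$. *)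

(* Defs.v *)
From HB Require Import structures.
From mathcomp Require Import all_boot all_order all_algebra.
From mathcomp Require Import classical_sets cardinality reals convex.

Set Implicit Arguments.
Unset Strict Implicit.
Unset Printing Implicit Defensive.

Import Order.TTheory GRing.Theory Num.Theory.

Local Open Scope classical_set_scope.
Local Open Scope card_scope.
Local Open Scope ring_scope.

Section Polytopes.
Variables (R : realType) (V : vectType R).
Implicit Types (P F A : set V) (v : V) (d : nat).

Definition conv_hull A : set V := smallest (fun B : set V => @convex_set R V B) A.

Definition polytope P := exists s : seq V, P = conv_hull [set` s].

(* d is the dimension of the affine hull of the nonempty set A; U is the
   direction of that affine hull, i.e. the span of the differences. *)
Definition has_dim A d :=
  A !=set0 /\
  exists U : {vspace V},
    [/\ \dim U = d,
        forall x y, A x -> A y -> x - y \in U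
      & forall W : {vspace V},
          (forall x y, A x -> A y -> x - y \in W) -> (U <= W)%VS].

(* P itself is a face (f = 0, c = 0); no dimension is assigned to the empty
   face, so it is neither a vertex nor an edge. *)
Definition face P F :=
  exists (f : {scalar V}) (c : R),
    (forall x, P x -> f x <= c) /\ F = [set x | P x /\ f x = c].

Definition vertex P v := face P [set v].

Definition edge P F := face P F /\ has_dim F 1.

Definition simple_polytope P :=
  polytope P /\
  exists2 d, has_dim P d &
    forall v, vertex P v -> [set E | edge P E /\ E v] #= `I_d.

(* The vertices are x0 :: s; freeness of the x - x0 is their affine
   independence, and the dimension is size s, so s = [::] gives a point. *)
Definition simplex A :=
  exists (x0 : V) (s : seq V),
    free [seq x - x0 | x <- s] /\ A = conv_hull [set` x0 :: s].

End Polytopes.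

(* R^S; the codomain is R^o so that the space carries a vectType structure. *)
Notation "''R[' R ]^ S" := {ffun S -> R^o}
  (at level 8, S at level 2, format "''R[' R ]^ S") : type_scope.

Section Hypersimplices.
Variables (R : realType) (S : finType).

Definition indic_vec (B : {set S}) : 'R[R]^S := [ffun x => (x \in B)%:R].

Definition hypersimplex (k : nat) : set 'R[R]^S :=
  conv_hull (indic_vec @` [set B : {set S} | #|B| = k]).

Definition is_matroid (k : nat) (M : {set {set S}}) :=
  [/\ M != finset.set0,
      forall I, I \in M -> #|I| = k
    & forall I J i, I \in M -> J \in M -> I <> J -> i \in I :\: J ->
        exists2 j, j \in J :\: I & j |: (I :\ i) \in M].

Definition matroid_polytope (M : {set {set S}}) : set 'R[R]^S :=
  conv_hull (indic_vec @` [set` M]).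

Definition is_partition (r : nat) (J : 'I_r -> {set S}) :=
  [/\ forall i, J i != finset.set0,
      forall i j, i != j -> [disjoint J i & J j]%B
    & forall x, exists i, x \in J i].

Definition restrict (J : {set S}) (x : 'R[R]^S) : 'R[R]^({j | j \in J}) :=
  [ffun j => x (val j)].

(* The product of the P i, as a subset of R^S through the identification of
   R^S with the product of the R^(J i) when J is a partition of S. *)
Definition block_prod (r : nat) (J : 'I_r -> {set S})
    (P : forall i, set 'R[R]^({j | j \in J i})) : set 'R[R]^S :=
  [set x | forall i, P i (restrict (J i) x)].

Definition prod_of_simplices (D : set 'R[R]^S) :=
  exists (r : nat) (J : 'I_r -> {set S})
         (P : forall i, set 'R[R]^({j | j \in J i})),
    [/\ is_partition J, forall i, simplex (P i) & D = block_prod P].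

End Hypersimplices.

Arguments hypersimplex : clear implicits.
Arguments matroid_polytope R {S} M.
Arguments block_prod {R S r} J P.

(* Main.v *)
(* At a base I the exchange directions e_j - e_i, for I - i + j a base, span
   the direction of the affine hull of the polytope, and each of them spans an
   edge at the vertex I. Simplicity therefore makes them linearly independent;
   all that is used is that the bipartite exchange graph of I has no 4-cycle.
   Pivoting on the middle edge of a path with three edges produces a 4-cycle in
   the exchange graph of another base, so the components of the exchange graph
   are stars (or points): a star centred in I meets every base in one element,
   a star centred outside I in all but one. Finally the bases are exactly the
   sets that meet each component in as many elements as I does. *)

Require Import Defs.
From HB Require Import structures.
From mathcomp Require Import all_boot all_order all_algebra.
From mathcomp Require Import classical_sets cardinality reals convex.
From mathcomp Require Import interval_inference lra zify.

Import Order.TTheory GRing.Theory Num.Theory.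
Local Open Scope classical_set_scope.
Local Open Scope card_scope.
Local Open Scope ring_scope.

Set Implicit Arguments.
Unset Strict Implicit.
Unset Printing Implicit Defensive.

(** * Base exchange and weights on bases *)

Section ExchangeGraph.
Variable S : finType.
Implicit Types (M : {set {set S}}) (A B I J : {set S}) (i j x y : S).

Lemma sum_mem (R : pzSemiRingType) A B :
  \sum_(x in A) (x \in B)%:R = #|A :&: B|%:R :> R.
Proof.
rewrite -sum1_card natr_sum [RHS](eq_bigl (fun x => (x \in A) && (x \in B))).
  by rewrite [RHS]big_mkcondr; apply: eq_bigr => x _; case: (_ \in _).
by move=> x; rewrite !inE.
Qed.

(** The edges of the bipartite exchange graph of [I], directed from the leaving element to the
    entering one. *)
Definition exchange M I i j :=
  [&& i \in I, j \notin I & j |: (I :\ i) \in M].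

Lemma big_exchange (V : zmodType) I i j (w : S -> V) : i \in I -> j \notin I ->
  \sum_(x in j |: (I :\ i)) w x = \sum_(x in I) w x - w i + w j.
Proof.
move=> iI jI; rewrite big_setU1 /=; last by rewrite !inE (negPf jI) andbF.
by rewrite (big_setD1 i iI) /= [w i + _]addrC addrK addrC.
Qed.

Lemma matroid_card k M A B : is_matroid k M -> A \in M -> B \in M ->
  #|A| = #|B|.
Proof. by move=> [_ cM _] /cM -> /cM ->. Qed.

Lemma exchange_ex k M A B i : is_matroid k M -> A \in M -> B \in M ->
  i \in A :\: B -> exists2 j, j \in B :\: A & exchange M A i j.
Proof.
move=> [_ _ exM] AM BM iAB; have AB : A <> B.
  by move=> AB; move: iAB; rewrite AB finset.setDv inE.
have [j jBA AM'] := exM _ _ _ AM BM AB iAB; exists j => //.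
by move: iAB jBA; rewrite /exchange !inE AM' => /andP[_ ->] /andP[-> _].
Qed.

(* If B had larger weight than I, then w b > w i for every exchange B - b + i
   towards I; this fails for b of minimal weight in B \ I, since I - i + b' is
   a base for some b' in B \ I and then w i = w b'. *)
Lemma exchange_weight_le (R : realDomainType) k M I (w : S -> R) :
    is_matroid k M -> I \in M ->
    (forall i j, exchange M I i j -> w i = w j) ->
  forall B, B \in M -> \sum_(x in B) w x <= \sum_(x in I) w x.
Proof.
move=> Mm IM wI B.
have [m] := ubnP #|B :\: I|; elim: m B => // m IHm B Bm BM.
have [//|wlt] := leP; have [BI0|[b0 b0BI]] := set_0Vmem (B :\: I).
  have BI : B = I.
    by apply/eqP; rewrite eqEcard (matroid_card Mm IM BM) leqnn -finset.setD_eq0 BI0 eqxx.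
  by rewrite BI ltxx in wlt.
have [b bBI bmin] : exists2 b, b \in B :\: I &
    forall c, c \in B :\: I -> w b <= w c.
  by case: (arg_minP w b0BI) => b bBI bmin; exists b.
have [i iIB /and3P[bB iB BM']] := exchange_ex Mm BM IM bBI.
have wB' : \sum_(x in i |: (B :\ b)) w x <= \sum_(x in I) w x.
  apply: IHm BM'; move: Bm; rewrite (cardsD1 b) bBI add1n ltnS; apply: leq_ltn_trans.
  apply/subset_leq_card/fintype.subsetP => x; rewrite !inE; move: iIB; rewrite !inE.
  case/andP=> _ iI /andP[xI] /orP[/eqP xi|/andP[-> ->]]; last by rewrite xI.
  by rewrite xi iI in xI.
have [b' b'BI eb'] := exchange_ex Mm IM BM iIB.
have := bmin _ b'BI; rewrite -(wI _ _ eb'); move: wB'; rewrite big_exchange //.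
move=> h1 h2; have := lt_le_trans wlt (le_trans _ h1).
by rewrite ltxx -addrA lerDl addrC subr_ge0 => /(_ h2).
Qed.

(** The inequality applies to both [w] and [- w]. Invariance at the single base [I] thus controls
    every base. *)
Lemma exchange_weight_eq (R : realDomainType) k M I (w : S -> R) :
    is_matroid k M -> I \in M ->
    (forall i j, exchange M I i j -> w i = w j) ->
  forall B, B \in M -> \sum_(x in B) w x = \sum_(x in I) w x.
Proof.
move=> Mm IM wI B BM; apply/eqP; rewrite eq_le (exchange_weight_le Mm IM) //=.
have := @exchange_weight_le _ _ _ _ (fun x => - w x) Mm IM _ B BM.
by rewrite !sumrN lerN2; apply=> i j /wI ->.
Qed.

(** All bases are quantified over, because the pivot below finds its 4-cycle at a base other than
    [I]. *)
Definition exchange_C4_free M := forall I i1 i2 j1 j2, I \in M ->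
  i1 != i2 -> j1 != j2 -> exchange M I i1 j1 -> exchange M I i1 j2 ->
  exchange M I i2 j1 -> exchange M I i2 j2 -> False.

Local Ltac split4 x i1 i2 j1 j2 E :=
  have [->|_] := eqVneq x i1; rewrite ?E //;
  have [->|_] := eqVneq x i2; rewrite ?E //;
  have [->|_] := eqVneq x j1; rewrite ?E //;
  have [->|_] := eqVneq x j2; rewrite ?E //.

(* Exchanging along the middle edge of a path j1 - i1 - j2 - i2 turns it into
   a 4-cycle of the exchange graph of the new base. *)
Lemma exchange_P4_free k M : is_matroid k M -> exchange_C4_free M ->
  forall I i1 i2 j1 j2, I \in M -> i1 != i2 -> j1 != j2 ->
    exchange M I i1 j1 -> exchange M I i1 j2 -> exchange M I i2 j2 -> False.
Proof.
move=> Mm C4 I i1 i2 j1 j2 IM i12 j12 e11 e12 e22.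
have [/and3P[i1I j1I M11] /and3P[_ j2I M12] /and3P[i2I _ M22]] := And3 e11 e12 e22.
have neI i j : i \in I -> j \notin I -> (i == j) = false.
  by move=> iI; apply: contraNF => /eqP <-.
have neI' i j : i \in I -> j \notin I -> (j == i) = false.
  by move=> iI jI; rewrite eq_sym neI.
have [i12F i21F] : (i1 == i2) = false /\ (i2 == i1) = false.
  by split; [|rewrite eq_sym]; exact: negPf.
have [j12F j21F] : (j1 == j2) = false /\ (j2 == j1) = false.
  by split; [|rewrite eq_sym]; exact: negPf.
pose E := (i12F, i21F, j12F, j21F, neI i1 j1, neI i1 j2, neI i2 j1, neI i2 j2,
  neI' i1 j1, neI' i1 j2, neI' i2 j1, neI' i2 j2, eqxx, i1I, i2I, negPf j1I, negPf j2I).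
have [|ne21] := boolP (j1 |: (I :\ i2) \in M).
  move=> M21; apply: (C4 I i1 i2 j1 j2) => //; exact/and3P.
have i2AC : i2 \in (j1 |: (I :\ i1)) :\: (j2 |: (I :\ i2)) by rewrite !inE !E.
(* Only [j2] and [i1] can replace [i2] here, and [i1] would make I - i2 + j1 a base, against [ne21].
   Hence I - i1 - i2 + j1 + j2 is a base. *)
have [j jCA /and3P[_ _ DM]] := exchange_ex Mm M11 M22 i2AC.
have {jCA DM} DM : j2 |: ((j1 |: (I :\ i1)) :\ i2) \in M.
  move: DM; have : (j == j2) || (j == i1).
    by move: jCA; rewrite !inE; split4 j i1 i2 j1 j2 E; case: (j \in I).
  case/orP=> /eqP -> //; suff -> : i1 |: ((j1 |: (I :\ i1)) :\ i2) = j1 |: (I :\ i2).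
    by rewrite (negPf ne21).
  by apply/setP=> x; rewrite !inE; split4 x i1 i2 j1 j2 E.
(* At the base I - i1 + j2, each of [j2], [i2] can be exchanged for each of [i1], [j1]. The results
   are I, I - i1 + j1, I - i2 + j2 and the base just found. *)
apply: (C4 (j2 |: (I :\ i1)) j2 i2 i1 j1) => //; rewrite ?E //;
  apply/and3P; split; rewrite ?inE ?E //.
- suff -> : i1 |: ((j2 |: (I :\ i1)) :\ j2) = I by [].
  by apply/setP=> x; rewrite !inE; split4 x i1 i2 j1 j2 E.
- suff -> : j1 |: ((j2 |: (I :\ i1)) :\ j2) = j1 |: (I :\ i1) by [].
  by apply/setP=> x; rewrite !inE; split4 x i1 i2 j1 j2 E.
- suff -> : i1 |: ((j2 |: (I :\ i1)) :\ i2) = j2 |: (I :\ i2) by [].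
  by apply/setP=> x; rewrite !inE; split4 x i1 i2 j1 j2 E.
- suff -> : j1 |: ((j2 |: (I :\ i1)) :\ i2) = j2 |: ((j1 |: (I :\ i1)) :\ i2) by [].
  by apply/setP=> x; rewrite !inE; split4 x i1 i2 j1 j2 E.
Qed.


(** * Components of the exchange graph *)

Definition exchange_adj M I x y := exchange M I x y || exchange M I y x.

Definition component M I x : {set S} :=
  [set y | connect (exchange_adj M I) x y]%SET.

Lemma exchange_adj_sym M I : symmetric (exchange_adj M I).
Proof. by move=> x y; rewrite /exchange_adj orbC. Qed.

Lemma connect_adj_sym M I : connect_sym (exchange_adj M I).
Proof. exact/sym_connect_sym/exchange_adj_sym. Qed.

Lemma component_id M I x : x \in component M I x.
Proof. by rewrite inE connect0. Qed.

Lemma component_sym M I x y : (x \in component M I y) = (y \in component M I x).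
Proof. by rewrite !inE connect_adj_sym. Qed.

Lemma component_eq M I x y : y \in component M I x ->
  component M I y = component M I x.
Proof.
rewrite inE => xy; apply/setP=> z; rewrite !inE.
by rewrite (same_connect (@connect_adj_sym M I) xy).
Qed.

Lemma exchange_adjE M I x y : exchange_adj M I x y ->
  (exchange M I x y /\ x \in I /\ y \notin I) \/
  (exchange M I y x /\ y \in I /\ x \notin I).
Proof. by case/orP=> e; [left|right]; case/and3P: (e). Qed.

(* In the absence of paths with three edges the diameter is at most two. *)
Lemma component_diam2 k M I x y : is_matroid k M -> exchange_C4_free M ->
  I \in M -> y \in component M I x ->
  [\/ x = y, exchange_adj M I x y |
    exists2 z, exchange_adj M I x z & exchange_adj M I z y].
Proof.
move=> Mm C4 IM; rewrite inE => /connectP[p pth ->] {y}.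
elim/last_ind: p pth => [|p z IHp]; first by constructor 1.
rewrite rcons_path last_rcons => /andP[/IHp {}IHp yz].
case: IHp yz => [<- xz|xy yz|[w xw wy] yz]; first by constructor 2.
- by constructor 3; exists (last x p).
have P4 := exchange_P4_free Mm C4 IM.
move: (last x p) wy yz => y wy yz.
have [->|xy] := eqVneq x y; first by constructor 2.
have [<-|wz] := eqVneq w z; first by constructor 2.
(* Edges join [I] to its complement, so the path x - w - y - z has only two possible orientations:
   [x] in [I] or [x] outside [I]. *)
exfalso; case/exchange_adjE: xw => [[xw [xI wI]]|[xw [wI xI]]];
  case/exchange_adjE: wy => [[wy [wI' yI]]|[wy [yI wI']]];
  case/exchange_adjE: yz => [[yz [yI' zI]]|[yz [zI yI']]];
  try solve [by case/negP: wI | by case/negP: wI'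
            | by case/negP: yI | by case/negP: yI'].
- by apply: P4 yz wy xw; rewrite // eq_sym.
- by apply: P4 xw wy yz; rewrite // eq_sym.
Qed.

(** Elements on opposite sides are at odd distance, so diameter two makes them adjacent: every
    component is complete bipartite. *)
Lemma component_exchange k M I i j : is_matroid k M -> exchange_C4_free M ->
  I \in M -> i \in I -> j \notin I -> j \in component M I i ->
  exchange M I i j.
Proof.
move=> Mm C4 IM iI jI /(component_diam2 Mm C4 IM)[ij|ij|[z iz zj]].
- by rewrite -ij iI in jI.
- by case/exchange_adjE: ij => [[]//|[_ [jI']]]; case/negP: jI.
by case/exchange_adjE: iz => [[_ [_ zI]]|[_ [_ /negP//]]];
  case/exchange_adjE: zj => [[_ [zI' _]]|[_ [jI' _]]]; [case/negP: zI|case/negP: jI].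
Qed.

(** Two elements on each side of a complete bipartite component would form a 4-cycle. *)
Lemma component_star k M I x : is_matroid k M -> exchange_C4_free M ->
  I \in M -> (#|I :&: component M I x| <= 1)%N \/
             (#|component M I x :\: I| <= 1)%N.
Proof.
move=> Mm C4 IM; case: leqP => [|/card_gt1P[i1 [i2 [+ + i12]]]]; first by left.
rewrite !(finset.in_setI, finset.in_setD) => /andP[i1I i1x] /andP[i2I i2x]; right.
rewrite leqNgt; apply/negP=> /card_gt1P[j1 [j2 [+ + j12]]].
rewrite !(finset.in_setI, finset.in_setD) => /andP[j1I j1x] /andP[j2I j2x].
have ex i j : i \in I -> i \in component M I x -> j \notin I ->
    j \in component M I x -> exchange M I i j.
  move=> iI ix jI jx; apply: component_exchange (Mm) C4 IM iI jI _.
  by rewrite (component_eq ix).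
by apply: (C4 I i1 i2 j1 j2) => //; apply: ex.
Qed.

(** An exchange at [I] stays inside one component, so the indicator of a component is an invariant
    weight. *)
Lemma base_component_card k M I B x : is_matroid k M -> I \in M -> B \in M ->
  #|B :&: component M I x| = #|I :&: component M I x|.
Proof.
move=> Mm IM BM; pose w y := (y \in component M I x)%:R : int.
have w_ex i j : exchange M I i j -> w i = w j.
  move=> ij; rewrite /w; congr (nat_of_bool _)%:R; rewrite !inE.
  have ij' : connect (exchange_adj M I) i j by apply: connect1; rewrite /exchange_adj ij.
  by rewrite ![connect _ x _]connect_adj_sym (same_connect (@connect_adj_sym M I) ij').
have /eqP := exchange_weight_eq Mm IM w_ex BM.
by rewrite !sum_mem eqr_nat => /eqP.
Qed.

(** Induction on the size of I \ B: move [B] one step towards [I] inside a component, to a set that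
    is a base by induction, then show that a suitable exchange from that base can only lead back to
    [B]. *)
Lemma component_card_base k M I B : is_matroid k M -> exchange_C4_free M ->
  I \in M -> (forall x, #|B :&: component M I x| = #|I :&: component M I x|) ->
  B \in M.
Proof.
move=> Mm C4 IM; have [m] := ubnP #|I :\: B|; elim: m B => // m IHm B Bm NB.
pose K := component M I.
(* I \ B and B \ I have equally many elements in a component, and one of them has at most one there
   because the component is a star. *)
have le1 x : (#|(I :\: B) :&: K x| <= 1)%N.
  have cIB : #|(I :\: B) :&: K x| = #|(B :\: I) :&: K x|.
    apply/eqP; rewrite -(eqn_add2l #|I :&: B :&: K x|).
    have cE A A' : (#|A :&: A' :&: K x| + #|(A :\: A') :&: K x|)%N = #|A :&: K x|.
      rewrite -(cardsID A' (A :&: K x)); congr (_ + _)%N; apply: eq_card => y;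
      by rewrite !inE; case: (y \in A); case: (y \in A') => /=; rewrite ?andbT ?andbF.
    by rewrite cE finset.setIC [I :&: B]finset.setIC finset.setIC cE NB.
  case: (component_star x Mm C4 IM) => [h|h]; last rewrite cIB;
    apply: leq_trans h; apply/subset_leq_card/fintype.subsetP => y;
    by rewrite !inE => /andP[/andP[a b] ->]; rewrite ?a ?b.
have [IB|[i iIB]] := set_0Vmem (I :\: B).
  suff -> : B = I by [].
  have sIB : I \subset B by rewrite -finset.setD_eq0 IB eqxx.
  apply/eqP; rewrite eq_sym finset.eqEsubset sIB /=; apply/fintype.subsetP => y yB.
  have /setP/(_ y) : I :&: K y = B :&: K y.
    by apply/eqP; rewrite eqEcard finset.setSI //= NB leqnn.
  by rewrite !finset.in_setI component_id yB !andbT.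
have [iI iB] : i \in I /\ i \notin B by move: iIB; rewrite inE => /andP[].
have [j] : exists j, j \in (B :&: K i) :\: (I :&: K i).
  apply/existsP; rewrite -[[exists _, _]]negbK negb_exists; apply/negP=> /forallP h.
  have sBI : B :&: K i \subset I :&: K i.
    by apply/fintype.subsetP=> y yB; move: (h y); rewrite finset.in_setD yB andbT negbK.
  have /setP/(_ i) : B :&: K i = I :&: K i.
    by apply/eqP; rewrite eqEcard sBI /= NB leqnn.
  by rewrite !finset.in_setI component_id iI (negPf iB).
rewrite finset.in_setD !finset.in_setI => /andP[+ /andP[jB jK]]; rewrite jK andbT => jI.
have ij : exchange M I i j := component_exchange Mm C4 IM iI jI jK.
have neij : i != j by apply: contraTneq jB => <-.
pose A := i |: (B :\ j).
have cA x : #|A :&: K x| = #|I :&: K x|.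
  rewrite -NB; have ijK : (i \in K x) = (j \in K x).
    rewrite /K ![_ \in component M I x]component_sym; move: jK => /component_eq.
    by move=> ->.
  have [iK|iK] := boolP (i \in K x); last first.
    apply: eq_card => y; rewrite !inE; have [->|_] := eqVneq y i.
      by rewrite -/(K x) (negPf iB) /=; move: iK; rewrite inE => /negPf.
    by have [->|//] := eqVneq y j; move: iK; rewrite ijK inE => /negPf ->; rewrite !andbF.
  have -> : A :&: K x = i |: ((B :&: K x) :\ j).
    apply/setP=> y;
    rewrite !(finset.in_setI, finset.in_setU, finset.in_setD, finset.in_set1).
    by have [->|_] := eqVneq y i; rewrite ?iK //= andbA.
  rewrite cardsU1 (cardsD1 j (B :&: K x)) !finset.in_setD !finset.in_setI jB -ijK iK.
  by rewrite (negPf iB) andbF.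
have AM : A \in M.
  apply: IHm => //; move: Bm; rewrite (cardsD1 i) iIB add1n ltnS; apply: leq_ltn_trans.
  apply/subset_leq_card/fintype.subsetP=> y; rewrite !inE negb_or.
  have [->|_] := eqVneq y i => //=; have [->|_] := eqVneq y j => //=.
  by rewrite (negPf jI) andbF.
have iA : i \in A by rewrite !inE eqxx.
have CM : j |: (I :\ i) \in M by case/and3P: ij.
(* Exchange [i] out of A = B - j + i towards the base I - i + j. If [j] enters, the result is [B];
   any other entering [j'] lies in I \ B and is refuted. *)
have [|j' + Aj'] := exchange_ex (i := i) Mm AM CM.
  by rewrite !inE eqxx (negPf neij).
have [j'E|j'j] := eqVneq j' j.
  move=> _; case/and3P: Aj' => _ _; rewrite j'E; suff -> : j |: (A :\ i) = B by [].
  apply/setP=> y; rewrite !inE; have [->|_] := eqVneq y j => //=.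
  by have [->|//] := eqVneq y i; rewrite (negPf iB).
rewrite !inE (negPf j'j) /= negb_or => /andP[/andP[j'i j'B] /andP[_ j'I]].
case/and3P: Aj' => _ j'A A'M.
(* The new base meets [K i] in as many elements as [A] does, so [j'] must make up for the loss of
   [i]. Then [i] and [j'] contradict [le1]. *)
have j'K : j' \in K i.
  have := base_component_card i Mm IM A'M; rewrite -/(K i) -(cA i).
  rewrite (cardsD1 i (A :&: K i)) finset.in_setI iA component_id add1n.
  have [//|j'K] := boolP (j' \in K i).
  suff -> : (j' |: (A :\ i)) :&: K i = (A :&: K i) :\ i by move=> /n_Sn.
  apply/setP=> y;
  rewrite !(finset.in_setI, finset.in_setD, finset.in_setU, finset.in_set1).
  by have [->|_] := eqVneq y j'; rewrite ?(negPf j'K) ?andbF //= -andbA.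
have := le1 i; rewrite leqNgt => /negP[]; apply/card_gt1P; exists i, j'.
by rewrite !(finset.in_setI, finset.in_setD) iI iB j'I j'B component_id j'K eq_sym.
Qed.

End ExchangeGraph.

(** * Linear functionals and dimension on convex hulls *)

Section ConvexHull.
Variables (R : realType) (V : vectType R).
Implicit Types (A B : set V) (x y : V) (t : R).

Definition segment_closed B :=
  forall x y t, 0 <= t -> t <= 1 -> B x -> B y -> B (t *: x + (1 - t) *: y).

Lemma conv_hull_min A B : segment_closed B -> A `<=` B -> conv_hull A `<=` B.
Proof.
move=> sB; apply: smallest_sub => x y l; rewrite !in_setE => Bx By.
exact: sB (ge0 l) (le1 l) Bx By.
Qed.

Lemma sub_conv_hull A : A `<=` conv_hull A.
Proof. exact: sub_gen_smallest. Qed.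

Lemma conv_hull_segment_closed A : segment_closed (conv_hull A).
Proof.
move=> x y t t0 t1 Ax Ay B [cB AB].
have := cB x y (Itv01 t0 t1); rewrite !in_setE; apply; [exact: Ax | exact: Ay].
Qed.

(** A convex combination reaches the bound [c] only if every point of nonzero weight does. The
    directions of the face f = c are therefore controlled by the generators on it. *)
Lemma conv_hull_linear_le A (f : {scalar V}) (c : R) (a : V) (U : {vspace V}) :
    (forall x, A x -> f x <= c) ->
    (forall x, A x -> f x = c -> x - a \in U) ->
  forall x, conv_hull A x -> f x <= c /\ (f x = c -> x - a \in U).
Proof.
move=> fA UA; apply: conv_hull_min => [x y t t0 t1 [fx Ux] [fy Uy]|x Ax]; last first.
  by split; [exact: fA | exact: UA].
have ->: t *: x + (1 - t) *: y - a = t *: (x - a) + (1 - t) *: (y - a).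
  by rewrite !scalerBr addrACA -opprD -scalerDl subrKC scale1r.
rewrite linearD !linearZ /=.
have t1' : 0 <= 1 - t by rewrite subr_ge0.
have ltx : t * f x <= t * c by exact: ler_wpM2l.
have lty : (1 - t) * f y <= (1 - t) * c by exact: ler_wpM2l.
have cE : c = t * c + (1 - t) * c by rewrite -mulrDl subrKC mul1r.
split=> [|fc]; first by rewrite [c in _ <= c]cE lerD.
(* Two inequalities whose sum is an equality are equalities. A zero weight gives no information on
   its point, but its term vanishes. *)
have [tx ty] : t * f x = t * c /\ (1 - t) * f y = (1 - t) * c by split; lra.
apply: memvD.
- have [->|t_neq0] := eqVneq t 0; first by rewrite scale0r mem0v.
  by apply/memvZ/Ux; apply: (mulfI t_neq0).
- have [->|t_neq1] := eqVneq (1 - t) 0; first by rewrite scale0r mem0v.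
  by apply/memvZ/Uy; apply: (mulfI t_neq1).
Qed.

(** The hull stays in the translate a + W, so [W] contains all differences and minimality of the
    direction space applies. *)
Lemma has_dim_le A d a (W : {vspace V}) :
  has_dim (conv_hull A) d -> (forall x, A x -> x - a \in W) -> (d <= \dim W)%N.
Proof.
move=> [_ [U [<- _ minU]]] AW; apply/dimvS/minU => x y Ax Ay.
have aW z : conv_hull A z -> z - a \in W.
  apply: (@conv_hull_min _ [set z | z - a \in W]) => // {Ax Ay}x {}y t _ _ /= xW yW.
  have ->: t *: x + (1 - t) *: y - a = t *: (x - a) + (1 - t) *: (y - a).
    by rewrite !scalerBr addrACA -opprD -scalerDl subrKC scale1r.
  by rewrite memvD // memvZ.
have -> : x - y = (x - a) - (y - a) by rewrite opprB addrA subrK.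
by rewrite memvB ?aW.
Qed.

End ConvexHull.

(** * Vertices and edges of the matroid polytope, and the effect of simplicity *)

Section MatroidPolytope.
Variables (R : realType) (S : finType).
Implicit Types (M : {set {set S}}) (B I J : {set S}) (i j : S) (w : S -> R).

Definition dot w (x : 'R[R]^S) : R := \sum_s w s * x s.

Lemma dot_is_scalar w : scalar (dot w).
Proof.
move=> a x y; rewrite /dot mulr_sumr -big_split; apply: eq_bigr => s _ /=.
by rewrite !ffunE mulrDr mulrCA.
Qed.

HB.instance Definition _ w :=
  GRing.isLinear.Build R 'R[R]^S R *%R (dot w) (dot_is_scalar w).

Lemma dot_indic w B : dot w (indic_vec R B) = \sum_(s in B) w s.
Proof.
rewrite /dot [RHS]big_mkcond; apply: eq_bigr => s _.
by rewrite ffunE; case: (s \in B); rewrite ?mulr1 ?mulr0.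
Qed.

Lemma indic_vec_sum B : indic_vec R B = \sum_(s in B) indic_vec R [set s]%SET.
Proof.
apply/ffunP=> t; rewrite sum_ffunE ffunE; have [tB|tB] := boolP (t \in B).
  rewrite (big_setD1 t tB) /= ffunE inE eqxx big1 ?addr0 // => s.
  by rewrite !inE => /andP[st _]; rewrite ffunE inE eq_sym (negPf st).
rewrite big1 // => s sB; rewrite ffunE inE; case: eqP => // ts.
by rewrite ts sB in tB.
Qed.

Definition exchange_dir i j : 'R[R]^S :=
  indic_vec R [set j]%SET - indic_vec R [set i]%SET.

Lemma exchange_dirE I i j : i \in I -> j \notin I ->
  indic_vec R (j |: (I :\ i)) - indic_vec R I = exchange_dir i j.
Proof.
move=> iI jI; rewrite [indic_vec R (_ |: _)]indic_vec_sum big_exchange //.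
by rewrite -indic_vec_sum addrAC [_ - _ - _]addrAC subrr sub0r addrC.
Qed.

(** A nonzero multiple has the same support, and [I] tells the leaving element from the entering
    one. Different exchanges at [I] thus span different lines. *)
Lemma exchange_dir_inj I i j i' j' : i \in I -> j \notin I -> i' \in I ->
  j' \notin I -> exchange_dir i' j' \in <[exchange_dir i j]>%VS ->
  (i, j) = (i', j').
Proof.
have neI x y : x \in I -> y \notin I -> (x == y) = false /\ (y == x) = false.
  by move=> xI yI; split; apply: contraNF yI => /eqP; [move=> <- | move=> ->].
move=> iI jI i'I j'I /vlineP[a /ffunP E].
have := E i'; have := E j'; rewrite !ffunE !inE !eqxx.
have [-> ->] := neI _ _ i'I j'I; have [-> _] := neI _ _ i'I jI.
have [_ ->] := neI _ _ iI j'I.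
have [->|_] := eqVneq j' j; last by rewrite !subr0 scaler0 => /eqP; rewrite oner_eq0.
have [->//|_ _] := eqVneq i' i.
by rewrite sub0r subrr scaler0 => /eqP; rewrite oppr_eq0 oner_eq0.
Qed.

Lemma base_indic M I : I \in M -> matroid_polytope R M (indic_vec R I).
Proof. by move=> IM; apply: sub_conv_hull; exists I. Qed.

Definition weight_face M w (c : R) : set 'R[R]^S :=
  [set x | matroid_polytope R M x /\ dot w x = c].

Lemma weight_faceP M I w (U : {vspace 'R[R]^S}) (c : R) :
    (forall B, B \in M -> \sum_(s in B) w s <= c) ->
    (forall B, B \in M -> \sum_(s in B) w s = c ->
       indic_vec R B - indic_vec R I \in U) ->
  face (matroid_polytope R M) (weight_face M w c) /\
  forall x, weight_face M w c x -> x - indic_vec R I \in U.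
Proof.
move=> wM UM; have wU : forall x, matroid_polytope R M x ->
    dot w x <= c /\ (dot w x = c -> x - indic_vec R I \in U).
  by apply: (conv_hull_linear_le (f := dot w)) => _ [B BM <-];
    rewrite /= dot_indic; [exact: wM | exact: UM].
split; first by exists (dot w), c; split=> // x /wU[].
by move=> x [/wU[_]].
Qed.

Lemma weight_face_base M I w (c : R) : I \in M -> \sum_(s in I) w s = c ->
  weight_face M w c (indic_vec R I).
Proof. by move=> IM wI; split; [exact: base_indic | rewrite dot_indic]. Qed.

(** The functional counting elements of [I] is maximal only at [I], since all bases have the same
    size. *)
Lemma base_vertex k M I : is_matroid k M -> I \in M ->
  vertex (matroid_polytope R M) (indic_vec R I).
Proof.
move=> Mm IM; pose w s : R := (s \in I)%:R.
have [|B BM|faceM FI] := @weight_faceP M I w 0%VS #|I|%:R.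
- move=> B BM; rewrite sum_mem ler_nat -(matroid_card Mm BM IM).
  exact/subset_leq_card/finset.subsetIl.
- rewrite sum_mem => /eqP; rewrite eqr_nat => /eqP cBI; rewrite memv0 subr_eq0.
  have sIB : I \subset B.
    have /eqP <- : B :&: I == I by rewrite eqEcard finset.subsetIr cBI leqnn.
    exact: finset.subsetIl.
  suff -> : B = I by [].
  by apply/esym/eqP; rewrite eqEcard sIB (matroid_card Mm BM IM) leqnn.
rewrite /vertex; have <- // : weight_face M w #|I|%:R = [set indic_vec R I].
apply/seteqP; split=> [x /FI|_ ->].
  by rewrite memv0 subr_eq0 => /eqP.
by apply: weight_face_base => //; rewrite sum_mem finset.setIid.
Qed.

Lemma exchange_edge k M I i j : is_matroid k M -> I \in M -> exchange M I i j ->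
  exists F, [/\ edge (matroid_polytope R M) F, F (indic_vec R I),
    F (indic_vec R (j |: (I :\ i))) &
    forall x, F x -> x - indic_vec R I \in <[exchange_dir i j]>%VS].
Proof.
move=> Mm IM /and3P[iI jI JM]; set J := j |: (I :\ i) in JM *.
have cB B : B \in M -> #|B| = #|I| by move=> BM; exact: matroid_card Mm BM IM.
(* Weight 2 on I - i, 1 on [i] and [j], 0 elsewhere. A base reaching [c] lies between I - i and I +
   j, hence is [I] or [J]. *)
pose w s : R := (s \in j |: I)%:R + (s \in I :\ i)%:R.
pose c : R := (#|I| + #|I :\ i|)%:R.
have wE B : \sum_(s in B) w s = (#|B :&: (j |: I)| + #|B :&: (I :\ i)|)%:R.
  by rewrite big_split /= !sum_mem natrD.
have le1 B : B \in M -> (#|B :&: (j |: I)| <= #|I|)%N.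
  by move=> BM; rewrite -(cB B BM); exact/subset_leq_card/finset.subsetIl.
have le2 B : (#|B :&: (I :\ i)| <= #|I :\ i|)%N.
  exact/subset_leq_card/finset.subsetIr.
have [|B BM|faceM FI] := @weight_faceP M I w <[exchange_dir i j]>%VS c.
- by move=> B BM; rewrite wE ler_nat leq_add ?le1.
- rewrite wE => /eqP; rewrite eqr_nat => /eqP cE.
  have [c1 c2] : #|B :&: (j |: I)| = #|I| /\ #|B :&: (I :\ i)| = #|I :\ i|.
    by move: (le1 B BM) (le2 B) cE; lia.
  have sBjI : B \subset j |: I.
    have /eqP <- : B :&: (j |: I) == B.
      by rewrite eqEcard finset.subsetIl c1 cB ?leqnn.
    exact: finset.subsetIr.
  have sIB : I :\ i \subset B.
    have /eqP <- : B :&: (I :\ i) == I :\ i by rewrite eqEcard finset.subsetIr c2 leqnn.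
    exact: finset.subsetIl.
  have [iB|iB] := boolP (i \in B).
    suff -> : B = I by rewrite subrr mem0v.
    apply/esym/eqP; rewrite eqEcard cB // leqnn andbT.
    by rewrite -(finset.setD1K iI) finset.subUset finset.sub1set iB.
  suff -> : B = J by rewrite exchange_dirE // memv_line.
  apply/eqP; rewrite eqEcard !cB // leqnn andbT; apply/fintype.subsetP => y yB.
  move/fintype.subsetP: sBjI => /(_ y yB); rewrite !inE => /orP[->//|->].
  have [yi|_] := eqVneq y i; last by rewrite orbT.
  by rewrite -yi yB in iB.
have wI : \sum_(s in I) w s = c.
  rewrite wE /c; congr (_ + _)%:R; apply: eq_card => y; rewrite !inE.
    by case: (y \in I); rewrite ?orbT ?andbF.
  by case: (y \in I); rewrite ?andbT ?andbF.
have wJ : \sum_(s in J) w s = c.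
  rewrite wE /c -(cB J JM); congr (_ + _)%:R; apply: eq_card => y; rewrite !inE.
    by case: (y == j) => //=; case: (y \in I); rewrite ?andbT ?andbF.
  by case: (y \in I); rewrite ?andbT ?andbF //; case: (y != i); rewrite ?orbT ?andbF.
have FI' : weight_face M w c (indic_vec R I) by apply: weight_face_base.
have FJ : weight_face M w c (indic_vec R J) by apply: weight_face_base.
exists (weight_face M w c); split => //; split=> //.
split; first by exists (indic_vec R I).
exists <[exchange_dir i j]>%VS; split.
- rewrite dim_vline; case: eqP => // /ffunP/(_ j).
  rewrite !ffunE !inE eqxx; case: eqP => [ji|_ /eqP]; last by rewrite subr0 oner_eq0.
  by rewrite ji iI in jI.
- move=> x y /FI Fx /FI Fy.
  have -> : x - y = (x - indic_vec R I) - (y - indic_vec R I).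
    by rewrite opprB addrA subrK.
  exact: memvB.
- move=> W WF; rewrite -memvE -(exchange_dirE iI jI); exact: WF.
Qed.

(** By duality: a vector outside [W] is detected by a functional vanishing on [W]. Such a functional
    is a weight invariant under exchanges at [I], so it agrees on [B] and [I]. *)
Lemma exchange_dir_span M k I B (W : {vspace 'R[R]^S}) : is_matroid k M ->
    I \in M -> (forall i j, exchange M I i j -> exchange_dir i j \in W) ->
  B \in M -> indic_vec R B - indic_vec R I \in W.
Proof.
move=> Mm IM WI BM; set v := _ - _; apply/negPn/negP => vW.
have [s us] : exists s, (v - projv W v) s != 0.
  apply/existsP; rewrite -[X in is_true X]negbK negb_exists; apply/negP=> /forallP u0.
  have vE : v - projv W v = 0.
    by apply/ffunP => s; rewrite [RHS]ffunE; apply/eqP/negPn/u0.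
  by move: vW; rewrite -(subrK (projv W v) v) vE add0r memv_proj.
(* The functional is coordinate [s] of the projection with kernel [W], evaluated at the unit
   vectors. *)
pose w t : R := (indic_vec R [set t]%SET - projv W (indic_vec R [set t]%SET)) s.
have wB (A : {set S}) :
    \sum_(t in A) w t = (indic_vec R A - projv W (indic_vec R A)) s.
  by rewrite indic_vec_sum linear_sum -sumrB sum_ffunE.
have wI i j : exchange M I i j -> w i = w j.
  move=> /WI ijW; have /ffunP/(_ s) := projv_id ijW.
  rewrite /exchange_dir linearB /w !ffunE => E; lra.
have := exchange_weight_eq Mm IM wI BM; rewrite !wB => E.
case/negP: us; apply/eqP; move: E; rewrite /v linearB !ffunE => E; lra.
Qed.

Lemma card_exchange_le k M I d : is_matroid k M -> I \in M ->
    [set E | edge (matroid_polytope R M) E /\ E (indic_vec R I)] #= `I_d ->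
  (#|[set p | exchange M I p.1 p.2]%SET| <= d)%N.
Proof.
move=> Mm IM cE; set T := [set p | _]%SET.
have FT (p : S * S) : exists F, exchange M I p.1 p.2 ->
  [/\ edge (matroid_polytope R M) F, F (indic_vec R I),
    F (indic_vec R (p.2 |: (I :\ p.1))) &
    forall x, F x -> x - indic_vec R I \in <[exchange_dir p.1 p.2]>%VS].
  have [ep|] := boolP (exchange M I p.1 p.2); last by exists set0.
  by have [F FP] := exchange_edge Mm IM ep; exists F.
have {FT}[F FT] := boolp.choice FT.
(* If [p] and [q] share an edge, the far endpoint for [q] lies on the line of [p], so both have the
   same direction. *)
have FinjT : {in [set` T] &, injective F}.
  move=> p q; rewrite !in_setE /= !inE => ep eq Fpq.
  have [_ _ _ Fp] := FT _ ep; have [_ _ Fq _] := FT _ eq.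
  case/and3P: ep => pI1 pI2 _; case/and3P: eq => qI1 qI2 _.
  rewrite [p]surjective_pairing [q]surjective_pairing.
  apply: (exchange_dir_inj pI1 pI2 qI1 qI2).
  by rewrite -(exchange_dirE qI1 qI2); apply: Fp; rewrite Fpq.
have [T0|[p0 _]] := set_0Vmem T; first by rewrite T0 cards0.
pose g m := F (nth p0 (enum T) m).
have nthT m : (m < #|T|)%N -> nth p0 (enum T) m \in T.
  by move=> mT; rewrite -mem_enum mem_nth // -cardE.
have ginj : {in `I_#|T| &, injective g}.
  move=> m n; rewrite !in_setE /= => mT nT /FinjT; rewrite !in_setE /= => E.
  by apply/eqP; rewrite -(nth_uniq p0 _ _ (enum_uniq T)) -?cardE // E ?nthT.
rewrite -card_le_II -(card_le_eqr cE) -(card_le_eql (inj_card_eq ginj)).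
apply: subset_card_le => _ [m /= /nthT + <-]; by rewrite inE => /FT[eF FI _ _].
Qed.

Lemma simple_exchange_C4_free k M : is_matroid k M ->
  simple_polytope (matroid_polytope R M) -> exchange_C4_free M.
Proof.
move=> Mm [_ [d dimM simM]] I i1 i2 j1 j2 IM i12 j12 e11 e12 e21 e22.
pose T := [set p | exchange M I p.1 p.2]%SET.
have cT : (#|T| <= d)%N.
  exact: card_exchange_le Mm IM (simM _ (base_vertex Mm IM)).
pose T' := T :\ (i1, j1).
pose s := [seq exchange_dir p.1 p.2 | p <- enum T'].
have dirT' i j : exchange M I i j -> (i, j) != (i1, j1) ->
    exchange_dir i j \in <<s>>%VS.
  by move=> ij ne; apply/memv_span/mapP; exists (i, j); rewrite // mem_enum !inE ne.
have dirW i j : exchange M I i j -> exchange_dir i j \in <<s>>%VS.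
  have [[-> ->] _|] := eqVneq (i, j) (i1, j1); last by move=> ? ?; apply: dirT'.
  have -> : exchange_dir i1 j1 =
      exchange_dir i2 j1 - exchange_dir i2 j2 + exchange_dir i1 j2.
    apply/ffunP=> t; rewrite !ffunE; lra.
  have [ne1 ne2 ne3] : [/\ (i2, j1) != (i1, j1), (i2, j2) != (i1, j1) &
      (i1, j2) != (i1, j1)].
    rewrite !xpair_eqE !eqxx ![i2 == _]eq_sym ![j2 == _]eq_sym.
    by rewrite (negPf i12) (negPf j12).
  by apply: memvD (memvB _ _) _; apply: dirT'.
have : (d <= size s)%N.
  apply: leq_trans (dim_span s); apply: (has_dim_le (a := indic_vec R I) dimM).
  by move=> _ [B BM <-]; apply: exchange_dir_span Mm IM _ BM.
rewrite size_map -cardE; apply/negP; rewrite -ltnNge; apply: leq_trans cT.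
by rewrite [#|T|](cardsD1 (i1, j1)) inE e11.
Qed.

End MatroidPolytope.

(** * Simplices among the hypersimplices, and products over blocks *)

Section Products.
Variables (R : realType) (S : finType).
Implicit Types (B : {set S}) (a b : S).

(** Reading a vanishing combination at a coordinate in [s] isolates one coefficient, multiplied by
    [c]. *)
Lemma free_diagonal (s : seq S) (f : S -> 'R[R]^S) (c : R) : c != 0 -> uniq s ->
  {in s &, forall a b, f a b = c * (a == b)%:R} -> free [seq f a | a <- s].
Proof.
move=> c0 us fE; apply/(@freeP _ _ _ (map_tuple f (in_tuple s))) => k k0 i.
have ms (j : 'I_(size s)) : tnth (in_tuple s) j \in s by exact: mem_tnth.
have XE (j : 'I_(size s)) : [seq f a | a <- s]`_j = f (tnth (in_tuple s) j).
  by set d := tnth_default (in_tuple s) j; rewrite (tnth_nth d) (nth_map d).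
have /ffunP/(_ (tnth (in_tuple s) i)) := k0.
rewrite sum_ffunE [RHS]ffunE (bigD1 i) //= big1 => [|j ji].
  rewrite addr0 ffunE XE fE ?ms // eqxx mulr1 => /eqP.
  by rewrite mulf_eq0 (negPf c0) orbF => /eqP.
rewrite ffunE XE fE ?ms // (_ : _ == _ = false) ?mulr0 ?scaler0 //.
by apply: contraNF ji => /eqP/esym;
   move/tuple_uniqP: (us : uniq (in_tuple s)) => /[apply] ->.
Qed.

(** For 0 and #|S| there is one vertex. For 1 and #|S|.-1 the vertices are the singletons and their
    complements; subtracting the one at [a] leaves a diagonal family on the other coordinates, with
    entries 1 and -1. The element [a] also ensures that the predecessor is not truncated. *)
Lemma simplex_hypersimplex a k : k \in [:: 0; 1; #|S|.-1; #|S|]%N ->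
  simplex (hypersimplex R S k).
Proof.
have sE (x0 : 'R[R]^S) s : free [seq x - x0 | x <- s] ->
    @indic_vec R S @` [set B : {set S} | #|B| = k] = [set` x0 :: s] ->
    simplex (hypersimplex R S k).
  by move=> fs E; exists x0, s; rewrite /hypersimplex E.
have S_gt0 : (0 < #|S|)%N by apply/card_gt0P; exists a.
have memT b : (b != a) = (b \in enum (predC1 a)) by rewrite mem_enum.
rewrite !inE => /or4P[] /eqP kE; rewrite kE in sE *.
- apply: (sE (indic_vec R finset.set0) [::]); first exact: nil_free.
  apply/seteqP; split=> [_ [B /eqP /= + <-]|x /=].
    by rewrite cards_eq0 => /eqP ->; rewrite inE.
  by rewrite inE => /eqP ->; exists finset.set0; rewrite //= cards0.
- apply: (sE (indic_vec R [set a]%SET)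
    [seq indic_vec R [set b]%SET | b <- enum (predC1 a)]).
    rewrite -map_comp; apply: (@free_diagonal _ _ 1); rewrite ?oner_eq0 ?enum_uniq //.
    move=> b c; rewrite -!memT => ba ca /=.
    by rewrite !ffunE !inE (negPf ca) subr0 mul1r eq_sym.
  apply/seteqP; split=> [_ [B /eqP /cards1P[b ->] <-]|x /=].
    rewrite /= inE; have [->|ba] := eqVneq b a; first by rewrite eqxx.
    by apply/orP; right; apply/mapP; exists b; rewrite // -memT.
  rewrite inE => /orP[/eqP->|/mapP[b _ ->]]; first by exists [set a]%SET; rewrite //= cards1.
  by exists [set b]%SET; rewrite //= cards1.
- apply: (sE (indic_vec R [set~ a]%SET)
    [seq indic_vec R [set~ b]%SET | b <- enum (predC1 a)]).
    rewrite -map_comp; apply: (@free_diagonal _ _ (-1));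
      rewrite ?oppr_eq0 ?oner_eq0 ?enum_uniq //.
    move=> b c; rewrite -!memT => ba ca /=.
    rewrite !ffunE !inE (negPf ca) mulN1r eq_sym.
    by case: (b == c); rewrite ?sub0r ?subrr ?oppr0.
  apply/seteqP; split=> [_ [B /= cB <-]|x /=].
    have /eqP/cards1P[b bE] : #|~: B| = 1%N.
      by apply: (@addnI #|B|); rewrite cardsC cB addn1 prednK.
    rewrite /= inE -[B]finset.setCK bE.
    have [->|ba] := eqVneq b a; first by rewrite eqxx.
    by apply/orP; right; apply/mapP; exists b; rewrite // -memT.
  rewrite inE => /orP[/eqP->|/mapP[b _ ->]].
    by exists [set~ a]%SET; rewrite //= cardsC1.
  by exists [set~ b]%SET; rewrite //= cardsC1.
- apply: (sE (indic_vec R [set: S]%SET) [::]); first exact: nil_free.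
  apply/seteqP; split=> [_ [B /= cB <-]|x /=].
    suff -> : B = [set: S]%SET by rewrite inE.
    by apply/eqP; rewrite eqEcard finset.subsetT cardsT cB leqnn.
  by rewrite inE => /eqP ->; exists [set: S]%SET; rewrite //= cardsT.
Qed.

Definition trace (J : {set S}) B : {set {j | j \in J}} := [set j | val j \in B]%SET.

Lemma card_trace J B : #|trace J B| = #|B :&: J|.
Proof.
rewrite -(card_imset _ val_inj); apply: eq_card => s; rewrite inE.
apply/imsetP/andP => [[j + ->]|[sB sJ]]; first by rewrite inE => jB; rewrite (valP j).
by exists (Sub s sJ); rewrite ?inE.
Qed.

Lemma restrict_indic J B : restrict J (indic_vec R B) = indic_vec R (trace J B).
Proof. by apply/ffunP => j; rewrite !ffunE inE. Qed.

Definition glue (J : {set S}) (x : 'R[R]^S) (y : 'R[R]^({j | j \in J})) :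
    'R[R]^S :=
  [ffun s => if insub s is Some j then y j else x s].

Lemma restrict_glue (J : {set S}) (x : 'R[R]^S) (y : 'R[R]^({j | j \in J})) :
  restrict J (glue x y) = y.
Proof. by apply/ffunP => j; rewrite !ffunE valK. Qed.

Lemma restrict_glue_disjoint (J J' : {set S}) (x : 'R[R]^S)
    (y : 'R[R]^({j | j \in J})) :
  [disjoint J & J']%B -> restrict J' (glue x y) = restrict J' x.
Proof.
move=> dJ; apply/ffunP => j; rewrite !ffunE insubF //.
by apply: contraTF (valP j) => jJ; rewrite (disjointFr dJ).
Qed.

Lemma glue_restrict J x : glue x (restrict J x) = x.
Proof.
by apply/ffunP => s; rewrite !ffunE; case: insubP => // j _ <-; rewrite ffunE.
Qed.

(* A point of the product is moved into the polytope one block at a time: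
   with the other blocks fixed, membership is a convex condition on the block
   which holds at the vertices of its hypersimplex. *)
Lemma matroid_polytope_block_prod r (J : 'I_r -> {set S}) (kk : 'I_r -> nat)
    (M : {set {set S}}) : is_partition J ->
    (forall B, B \in M <-> forall i, #|B :&: J i| = kk i) ->
  matroid_polytope R M =
    block_prod J (fun i => hypersimplex R {j | j \in J i} (kk i)).
Proof.
move=> [_ disjJ coverJ] MP; apply/seteqP; split.
  apply: conv_hull_min => [x y t t0 t1 Px Py i|_ [B BM <-] i]; last first.
    rewrite restrict_indic; apply: sub_conv_hull; exists (trace (J i) B) => //=.
    by rewrite card_trace; apply: (MP B).1.
  have -> : restrict (J i) (t *: x + (1 - t) *: y) =
      t *: restrict (J i) x + (1 - t) *: restrict (J i) y.
    by apply/ffunP => j; rewrite !ffunE.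
  exact: conv_hull_segment_closed t0 t1 (Px i) (Py i).
move=> x Px; pose at_vertex (x : 'R[R]^S) i := exists2 C : {set {j | j \in J i}},
  #|C| = kk i & restrict (J i) x = indic_vec R C.
(* [A] holds the blocks not yet known to be at a vertex; induction on its size. *)
suff claim (A : {set 'I_r}) (y : 'R[R]^S) :
    block_prod J (fun i => hypersimplex R {j | j \in J i} (kk i)) y ->
    (forall i, i \notin A -> at_vertex y i) -> matroid_polytope R M y.
  by apply: (claim [set: 'I_r]%SET x Px) => i; rewrite finset.in_setT.
have [m] := ubnP #|A|; elim: m A y => // m IHm A y Am Py Ay.
have [A0|[i iA]] := set_0Vmem A.
  have vy i : at_vertex y i by apply: Ay; rewrite A0 inE.
  (* With every block at a vertex, [y] is a 0/1 vector, and the set where it equals 1 has the block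
     sizes of a base. *)
  have yE : y = indic_vec R [set s | y s == 1]%SET.
    apply/ffunP => s; rewrite ffunE inE; have [i si] := coverJ s.
    have [C _ /ffunP/(_ (Sub s si))] := vy i; rewrite !ffunE /= => ->.
    by case: (_ \in C); rewrite ?eqxx // eq_sym oner_eq0.
  rewrite yE; apply: base_indic; apply/MP => i.
  have [C <- /ffunP yC] := vy i; rewrite -card_trace; congr #|pred_of_set _|.
  apply/setP => j; rewrite !inE; have := yC j; rewrite !ffunE => ->.
  by case: (j \in C); rewrite ?eqxx // eq_sym oner_eq0.
rewrite -(glue_restrict (J i) y).
suff sub : hypersimplex R {j | j \in J i} (kk i) `<=`
    [set z | matroid_polytope R M (glue y z)].
  exact: sub (Py i).
apply: conv_hull_min => [z z' t t0 t1 Mz Mz'|_ [C cC <-]] /=.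
  (* [glue y] is affine: off the block both sides equal [y], as the weights sum to 1. *)
  have -> : glue y (t *: z + (1 - t) *: z') = t *: glue y z + (1 - t) *: glue y z'.
    apply/ffunP => s; rewrite !ffunE; case: insubP => [j _ _|_].
      by rewrite !ffunE.
    by rewrite -scalerDl subrKC scale1r.
  exact: conv_hull_segment_closed t0 t1 Mz Mz'.
apply: (IHm (A :\ i)).
- by move: Am; rewrite (cardsD1 i) iA add1n ltnS.
- move=> i'; have [->|ii'] := eqVneq i' i.
    by rewrite restrict_glue; apply: sub_conv_hull; exists C.
  by rewrite restrict_glue_disjoint ?disjJ // eq_sym.
- move=> i'; rewrite !inE negb_and negbK; have [-> _|ii' /= i'A] := eqVneq i' i.
    by exists C; rewrite // restrict_glue.
  by rewrite /at_vertex restrict_glue_disjoint ?disjJ 1?eq_sym //; apply: Ay.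
Qed.

End Products.

(** * Decomposition along the components of one base *)

Theorem theoremB (R : realType) (n k : nat) (M : {set {set 'I_n}})
    (Delta : set 'R[R]^('I_n))
    (hk : (k <= n)%N) (hn : (1 <= n)%N)
    (hM : is_matroid k M) (hDelta : Delta = matroid_polytope R M)
    (hsub : Delta `<=` hypersimplex R 'I_n k)
    (hsimple : simple_polytope Delta) :
  (exists (r : nat) (J : 'I_r -> {set 'I_n}) (kk : 'I_r -> nat),
    [/\ is_partition J,
        (\sum_(i < r) kk i = k)%N,
        forall i, kk i \in [:: 0; 1; #|J i|.-1; #|J i|]%N
      & Delta =
          block_prod J (fun i => hypersimplex R {j | j \in J i} (kk i))])
  /\ prod_of_simplices Delta.
Proof.
have C4 : exchange_C4_free M.
  by apply: (simple_exchange_C4_free (R := R) hM); rewrite -hDelta.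
have [I IM] : exists I, I \in M by apply/finset.set0Pn; case: hM.
pose P := [set component M I x | x in 'I_n]%SET.
pose J (i : 'I_#|P|) : {set 'I_n} := enum_val i.
pose kk i := #|I :&: J i|.
have JE i : exists x, J i = component M I x.
  by have /imsetP[x _ Ex] := enum_valP i; exists x.
have compP x : component M I x \in P by apply/imsetP; exists x.
have Jcomp x : exists i, J i = component M I x.
  by exists (enum_rank_in (compP x) (component M I x)); rewrite /J enum_rankK_in.
have partJ : is_partition J.
  split=> [i|i j|x]; last first.
  - by have [i Ji] := Jcomp x; exists i; rewrite Ji component_id.
  - apply: contraNT => /pred0Pn[y /andP[]]; rewrite /= => yi yj.
    apply/eqP/enum_val_inj; rewrite -/(J i) -/(J j); move: yi yj.
    by have [x ->] := JE i; have [z ->] := JE j; move=> /component_eq <- /component_eq.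
  - by have [x ->] := JE i; apply/finset.set0Pn; exists x; exact: component_id.
(* The star bound on I :&: K gives 0 or 1; the one on K \ I gives #|K| or #|K|.-1. *)
have kkE i : kk i \in [:: 0; 1; #|J i|.-1; #|J i|]%N.
  rewrite /kk; have [x ->] := JE i.
  have := cardsID I (component M I x); rewrite finset.setIC !inE.
  by case: (component_star x hM C4 IM); lia.
have DeltaE : Delta = block_prod J (fun i => hypersimplex R {j | j \in J i} (kk i)).
  rewrite hDelta; apply: matroid_polytope_block_prod => // B; split=> [BM i|cB].
    by rewrite /kk; have [x ->] := JE i; apply: base_component_card hM IM BM.
  by apply: (component_card_base hM C4 IM) => x; have [i <-] := Jcomp x.
split; last first.
  exists #|P|, J, (fun i => hypersimplex R {j | j \in J i} (kk i)); split=> // i.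
  have [/(_ i)/finset.set0Pn[a aJ] _ _] := partJ.
  by apply: (simplex_hypersimplex R (Sub a aJ : {j | j \in J i})); rewrite card_sig.
exists #|P|, J, kk; split=> //.
(* Count [I] by sorting its elements according to their components. *)
have [_ cM _] := hM; rewrite -(cM I IM) /kk -(big_enum_val (fun K => #|I :&: K|)).
rewrite -sum1_card (partition_big (component M I) (mem P)) //=.
apply: eq_bigr => K /imsetP[x _ ->]; rewrite -sum1_card; apply: eq_bigl => y.
rewrite finset.in_setI; congr (_ && _); apply/idP/eqP => [/component_eq //|<-].
exact: component_id.
Qed.
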